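(* Let $p=\big((x_1,y_1),(x_2,y_2)\big)$ be a pair of points of $(0,1)^2$ with $x_1<x_2$ and $y_2<y_1$, and let $T=Z_p$ be the zipper map of parameter $p$. Assume that $T$ is hypersensitive, i.e. $\min\big(\frac{y_1}{x_1},\frac{y_1-y_2}{x_2-x_1},\frac{1-y_2}{1-x_2}\big)>1$, and that at least one of the following holds: (1) $x_1+x_2=y_1+y_2=1$; or (2) $y_1^2>y_2$ and $y_1>(2-y_2)y_2$. Let $\Omega$ be a finite set. Then any map $S:\Omega\to\Omega$ is embedded in $T$, i.e. there exists an injective map $\pi:\Omega\to[0,1]$ such that $\pi\circ S=T\circ\pi$.
   Context: Let $\mathscr{C}^0_0$ be the set of continuous maps $f:[0,1]\to[0,1]$ with $f(0)=0$ and $f(1)=1$, with the uniform distance. For $p=\big((x_1,y_1),(x_2,y_2)\big)$ with both points in $(0,1)^2$, $x_1<x_2$, $y_2<y_1$, let $\Phi_p:\mathscr{C}^0_0\to\mathscr{C}^0_0$ be defined by: $\Phi_pf(x)=y_1 f\big(\frac{x}{x_1}\big)$ if $x\in[0,x_1]$; $\Phi_pf(x)=y_1-(y_1-y_2)f\big(\frac{x-x_1}{x_2-x_1}\big)$ if $x\in[x_1,x_2]$; $\Phi_pf(x)=y_2+(1-y_2)f\big(\frac{x-x_2}{1-x_2}\big)$ if $x\in[x_2,1]$. The map $\Phi_p$ is a contraction in the uniform norm; the zipper map $Z_p\in\mathscr{C}^0_0$ of parameter $p$ is its unique fixed point. *)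

(* Defs.v *)
From HB Require Import structures.
From mathcomp Require Import all_boot all_order all_algebra.
From mathcomp Require Import all_classical all_reals all_analysis.
From mathcomp Require Import ring lra.
Set Implicit Arguments.
Unset Strict Implicit.
Unset Printing Implicit Defensive.
Import Order.TTheory GRing.Theory Num.Theory.
Import numFieldNormedType.Exports.
Local Open Scope classical_set_scope.
Local Open Scope ring_scope.

(* Self-maps of [0, 1] are represented by functions [R -> R] of which only the
   values on [0, 1] are relevant. *)
Definition unit_fix_maps (R : realType) : set (R -> R) :=
  [set f : R -> R | [/\ {within `[0 : R, 1], continuous f},
               (forall x, x \in `[0 : R, 1] -> f x \in `[0, 1]),
               f 0 = 0 & f 1 = 1]].

(* The three branches agree at [x1] and at [x2] as soon as [f 0 = 0] and
   [f 1 = 1], so the way in which ties are broken is immaterial. *)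
Definition zipper_op (R : realType) (x1 y1 x2 y2 : R) (f : R -> R) : R -> R :=
  fun x =>
    if x <= x1 then y1 * f (x / x1)
    else if x <= x2 then y1 - (y1 - y2) * f ((x - x1) / (x2 - x1))
    else y2 + (1 - y2) * f ((x - x2) / (1 - x2)).

(* The fixed point is determined on [0, 1] only; there it exists and is unique,
   see [zipper_map_exists] and [zipper_map_unique]. *)
Definition is_zipper_map (R : realType) (x1 y1 x2 y2 : R) (T : R -> R) : Prop :=
  unit_fix_maps T /\
  forall x, x \in `[0, 1] -> zipper_op x1 y1 x2 y2 T x = T x.

Definition embedded_in (R : realType) (Omega : Type) (S : Omega -> Omega)
    (T : R -> R) : Prop :=
  exists pi : Omega -> R,
    [/\ injective pi,
        (forall w, pi w \in `[0, 1]) &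
        pi \o S = T \o pi].

Lemma zipper_map_unique (R : realType) (x1 y1 x2 y2 : R) (T U : R -> R) :
  0 < x1 -> x1 < x2 -> x2 < 1 -> 0 < y2 -> y2 < y1 -> y1 < 1 ->
  is_zipper_map x1 y1 x2 y2 T -> is_zipper_map x1 y1 x2 y2 U ->
  {in `[0, 1], T =1 U}.
Proof.
move=> x10 x12 x21 y20 y21 y11 [[cT _ _ _] fT] [[cU _ _ _] fU].
have cTU : {within `[0 : R, 1], continuous (fun x => `|T x - U x|)}.
  move=> x; apply: cvg_norm; apply: cvgB; [exact: cT|exact: cU].
have [m m01 mP] := EVT_max ler01 cTU.
suff m0 : `|T m - U m| <= 0.
  move=> x x01; apply/eqP; rewrite -subr_eq0 -normr_le0.
  exact: le_trans (mP x x01) m0.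
have scale (c u : R) : 0 < c -> c < 1 -> u \in `[0, 1] ->
    `|T m - U m| <= c * `|T u - U u| -> `|T m - U m| <= 0.
  by move=> c0 c1 /mP mu; have := normr_ge0 (T u - U u); nra.
have in01 (a b : R) : 0 <= a -> a <= b -> 0 < b -> a / b \in `[0, 1].
  move=> a0 ab b0; rewrite in_itv /= ler_pdivrMr// mul1r ab andbT.
  by rewrite divr_ge0// ltW.
have [m0 m1] : 0 <= m /\ m <= 1 by move: m01; rewrite in_itv => /andP.
have := fT m m01; have := fU m m01; rewrite /zipper_op.
case: (leP m x1) => mx1; last case: (leP m x2) => mx2.
- move=> Ue Te; apply: (scale y1 (m / x1)); [lra|lra|exact: in01|].
  by rewrite -Ue -Te -mulrBr normrM gtr0_norm//; lra.
- move=> Ue Te; apply: (scale (y1 - y2) ((m - x1) / (x2 - x1)));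
    [lra|lra|by apply: in01; lra|].
  rewrite -Ue -Te distrC [X in `|X|](_ : _ = (y1 - y2) *
    (T ((m - x1) / (x2 - x1)) - U ((m - x1) / (x2 - x1)))); last by ring.
  by rewrite normrM gtr0_norm//; lra.
- move=> Ue Te; apply: (scale (1 - y2) ((m - x2) / (1 - x2)));
    [lra|lra|by apply: in01; lra|].
  rewrite -Ue -Te [X in `|X|](_ : _ = (1 - y2) *
    (T ((m - x2) / (1 - x2)) - U ((m - x2) / (1 - x2)))); last by ring.
  by rewrite normrM gtr0_norm//; lra.
Qed.

Lemma zipper_map_exists (R : realType) (x1 y1 x2 y2 : R) :
  0 < x1 -> x1 < x2 -> x2 < 1 -> 0 < y2 -> y2 < y1 -> y1 < 1 ->
  exists T : R -> R, is_zipper_map x1 y1 x2 y2 T.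
Proof.
move=> x10 x12 x21 y20 y21 y11.
(* On maps extended by 0 on the left of [0, 1] and by 1 on its right,
   [zipper_op] is a plain linear combination. *)
pose ext (h : R -> R) := [/\ (forall x : R, x <= 0 -> h x = 0),
  (forall x, 1 <= x -> h x = 1) & (forall x, 0 <= h x <= 1)].
pose G (h : R -> R) x := y1 * h (x / x1) - (y1 - y2) * h ((x - x1) / (x2 - x1))
  + (1 - y2) * h ((x - x2) / (1 - x2)).
have dle0 (a b : R) : 0 < b -> a <= 0 -> a / b <= 0.
  by move=> b0 a0; rewrite ler_pdivrMr// mul0r.
have dge1 (a b : R) : 0 < b -> b <= a -> 1 <= a / b.
  by move=> b0 ab; rewrite ler_pdivlMr// mul1r.
have conv (t : R) : 0 <= t <= 1 -> forall y : R, 0 <= y -> 0 <= y * t <= y.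
  move=> /andP[t0 t1] y y0; rewrite mulr_ge0//=.
  by rewrite -[leRHS]mulr1 ler_wpM2l.
have [yp1 yp12 yp2] : [/\ 0 <= y1, 0 <= y1 - y2 & 0 <= 1 - y2].
  by split; lra.
have b1 : 0 < x2 - x1 by lra.
have b2 : 0 < 1 - x2 by lra.
have GE h : ext h -> G h =1 zipper_op x1 y1 x2 y2 h.
  move=> [h0 h1 _] x; rewrite /G /zipper_op.
  case: (leP x x1) => xx1; last case: (leP x x2) => xx2.
  - rewrite (h0 ((x - x1) / _)); last by apply: dle0 => //; lra.
    rewrite (h0 ((x - x2) / _)); last by apply: dle0 => //; lra.
    by ring.
  - rewrite (h1 (x / x1)); last by apply: dge1 => //; lra.
    rewrite (h0 ((x - x2) / _)); last by apply: dle0 => //; lra.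
    by ring.
  - rewrite (h1 (x / x1)); last by apply: dge1 => //; lra.
    rewrite (h1 ((x - x1) / _)); last by apply: dge1 => //; lra.
    by ring.
have Gext h : ext h -> ext (G h).
  move=> eh; have [h0 h1 h01] := eh; split=> x.
  - move=> x0; rewrite GE// /zipper_op ifT; last by lra.
    by rewrite h0 ?mulr0//; apply: dle0.
  - move=> x1'; rewrite GE// /zipper_op !ifF; [|apply/negbTE; lra..].
    by rewrite h1; [ring|apply: dge1 => //; lra].
  - rewrite GE// /zipper_op.
    case: (leP x x1) => xx1; last case: (leP x x2) => xx2.
    + have /conv/(_ _ yp1)/andP[] := h01 (x / x1) => a b;
      apply/andP; split; lra.
    + have /conv/(_ _ yp12)/andP[] := h01 ((x - x1) / (x2 - x1)) => a b;
      apply/andP; split; lra.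
    + have /conv/(_ _ yp2)/andP[] := h01 ((x - x2) / (1 - x2)) => a b;
      apply/andP; split; lra.
pose c := Num.max y1 (1 - y2).
have c1 : c < 1 by rewrite /c gt_max; apply/andP; split; lra.
have y1c : y1 <= c by rewrite /c le_max lexx.
have y2c : 1 - y2 <= c by rewrite /c le_max lexx orbT.
have c0 : 0 < c by lra.
have Gcontr f g (e : R) : ext f -> ext g -> (forall x, `|f x - g x| <= e) ->
    forall x, `|G f x - G g x| <= c * e.
  move=> ef eg fg x; rewrite !GE// /zipper_op.
  case: (leP x x1) => xx1; last case: (leP x x2) => xx2.
  - rewrite -mulrBr normrM ler_pM// gtr0_norm//; lra.
  - rewrite distrC [X in `|X|](_ : _ = (y1 - y2) *
      (f ((x - x1) / (x2 - x1)) - g ((x - x1) / (x2 - x1)))); last by ring.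
    by rewrite normrM ler_pM// gtr0_norm//; lra.
  - rewrite [X in `|X|](_ : _ = (1 - y2) *
      (f ((x - x2) / (1 - x2)) - g ((x - x2) / (1 - x2)))); last by ring.
    by rewrite normrM ler_pM// gtr0_norm//; lra.
pose h n := iter n G (fun x => Num.max 0 (Num.min x 1)).
have eh n : ext (h n).
  elim: n => [|n ih]; last exact: Gext.
  rewrite /h /=; split=> x.
  - by move=> x0; rewrite min_l ?max_l//; lra.
  - by move=> x1'; rewrite min_r ?max_r.
  - by rewrite le_max lexx ge_max ler01 ge_min lexx orbT.
have hcauchy n m x : `|h (n + m)%N x - h n x| <= c ^+ n.
  elim: n x => [|n ih] x.
    rewrite add0n expr0; have [_ _ /(_ x) a] := eh m.
    by have [_ _ /(_ x) b] := eh 0%N; rewrite ler_norml; lra.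
  by rewrite addSn exprS; apply: Gcontr.
have cn0 : (fun n => c ^+ n) @ \oo --> (0 : R).
  by apply: cvg_expr; rewrite gtr0_norm.
pose L x := limn (fun n => h n x).
have hL x : (fun n => h n x) @ \oo --> L x.
  apply: cauchy_cvg; apply/cauchy_exP => e e0.
  have /cvgrPdist_lt/(_ e e0)[N _ /(_ N (leqnn N))] := cn0.
  rewrite sub0r normrN gtr0_norm ?exprn_gt0// => cNe.
  exists (h N x); exists N => // n /= Nn.
  rewrite /ball /= distrC; apply: le_lt_trans cNe.
  by rewrite -(subnKC Nn).
have hLc n x : `|L x - h n x| <= c ^+ n.
  have cv : (fun m => `|h m x - h n x|) @ \oo --> `|L x - h n x|.
    by apply: cvg_norm; apply: cvgB; [exact: hL|exact: cvg_cst].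
  rewrite -(cvg_lim (@Rhausdorff R) cv); apply: limr_le.
    by apply/cvg_ex; eexists; exact: cv.
  by exists n => // m /= nm; rewrite -(subnKC nm).
have eL : ext L.
  have lim_le x : 0 <= L x <= 1.
    apply/andP; split; rewrite /L; [apply: limr_ge|apply: limr_le];
      try (by apply/cvg_ex; exists (L x); exact: hL);
      by apply: nearW => n; have [_ _ /(_ x)/andP[]] := eh n.
  split=> // x xb; rewrite /L.
  - rewrite (_ : (fun n => _) = cst 0) ?lim_cst//.
    by apply/funext => n; have [-> //] := eh n.
  - rewrite (_ : (fun n => _) = cst 1) ?lim_cst//.
    by apply/funext => n; have [_ -> //] := eh n.
have GL x : G L x = L x.
  have cG : (fun n => G (h n) x) @ \oo --> G L x.
    by apply: cvgD; [apply: cvgB|]; apply: cvgMl_tmp; exact: hL.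
  have cS : (fun n => h n.+1 x) @ \oo --> L x.
    by rewrite (@cvg_shiftS R (fun n => h n x)); exact: hL.
  exact: (cvg_unique (@Rhausdorff R) cG cS).
have ch n : continuous (h n).
  elim: n => [|n ih] x /=.
    apply: (@continuous_max R R (cst 0) (fun z => Num.min z 1)).
      exact: cst_continuous.
    apply: (@continuous_min R R id (cst 1)); last exact: cst_continuous.
    exact: cvg_id.
  have ca (a b : R) : (fun z => h n ((z - a) / b)) @ x --> h n ((x - a) / b).
    apply: (@continuous_comp R R R (fun z => (z - a) / b) (h n) x);
      last exact: ih.
    by apply: cvgMr_tmp; apply: cvgB; [exact: cvg_id|exact: cvg_cst].
  apply: cvgD; [apply: cvgB|]; apply: cvgMl_tmp => //.
  by have := ca 0 x1; under eq_fun do rewrite subr0; rewrite subr0.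
have cL : continuous L.
  move=> x; apply/cvgrPdist_lt => e e0.
  have e30 : 0 < e / 3 by lra.
  have /cvgrPdist_lt/(_ _ e30)[N _ /(_ N (leqnn N))] := cn0.
  rewrite sub0r normrN gtr0_norm ?exprn_gt0// => cNe.
  have /cvgrPdist_lt/(_ _ e30) := ch N x.
  apply: filterS => t.
  have := hLc N x; have := hLc N t; rewrite ler_norml ler_norml !ltr_norml.
  by lra.
have [L0 L1 L01] := eL.
exists L; split; first split.
- exact: continuous_subspaceT.
- by move=> x _; rewrite in_itv /=; exact: L01.
- exact: L0.
- exact: L1.
- by move=> x _; rewrite -GE.
Qed.

(* Main.v *)
(* The diagonal is crossed by the graph of T inside the middle branch.  Zooming
   into cells on which the graph is an affine copy of itself flattens the
   diagonal, because all slopes exceed 1; so it suffices that the graph crosses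
   almost horizontal lines many times.  Under (1) this is needed at height 1/2
   only, the centre of symmetry.  Under (2) it holds at every height in (0, 1):
   in the copies over the outer branches the critical heights y2 and y1 become
   y2 / y1 and (y1 - y2) / (1 - y2), and (2) says that these lie in (y2, y1).
   Thus for each n there are an interval [c, d] and n disjoint subintervals on
   which T rises from at most c to at least d.  A monotone right inverse on each
   of them turns the equations T (pi w) = pi (S w) into a fixed-point problem
   for a monotone map. *)
Require Import Defs.
From mathcomp Require Import all_boot all_order all_algebra.
From mathcomp Require Import all_classical all_reals all_analysis.
From mathcomp Require Import ring lra.
Set Implicit Arguments.
Unset Strict Implicit.
Unset Printing Implicit Defensive.
Import Order.TTheory GRing.Theory Num.Theory.
Import numFieldNormedType.Exports.
Local Open Scope ring_scope.

(** * Rises *)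

Section Rises.
Variable R : realType.
Implicit Types (f g phi : R -> R) (a b c lo hi : R) (n m : nat).

(** The base case keeps [a <= b], so that an empty chain still records an interval; concatenation
    with one widens the endpoints. *)
Fixpoint rises f n lo hi a b : Prop :=
  if n is n'.+1 then
    exists p q, [/\ a <= p, p <= q, f p <= lo, hi <= f q
                 & rises f n' lo hi q b]
  else a <= b.

Lemma rises_le f n lo hi a b : rises f n lo hi a b -> a <= b.
Proof.
elim: n a => [//|n IH] a /= [p [q [ap pq _ _ /IH]]]; lra.
Qed.

Lemma rises_cat f n m lo hi a b c :
  rises f n lo hi a b -> rises f m lo hi b c -> rises f (n + m) lo hi a c.
Proof.
elim: n a => [|n IH] a /=.
  case: m => [|m] /=; first exact: le_trans.
  move=> ab [p [q [bp pq fp fq r]]]; exists p, q; split=> //; lra.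
move=> [p [q [ap pq fp fq r]]] r'; exists p, q; split=> //; exact: IH.
Qed.

Lemma rises_widen f n lo hi a b a' b' : a' <= a -> b <= b' ->
  rises f n lo hi a b -> rises f n lo hi a' b'.
Proof.
move=> a'a bb' r.
have := @rises_cat f 0 n lo hi a' a b a'a r.
by move=> /(@rises_cat f n 0 lo hi a' b b')/(_ bb'); rewrite addn0.
Qed.

(** [f] and [g] may differ so that, for an upside-down copy of the graph, [f] can be the negation of
    [g]. *)
Lemma rises_map f g phi n lo hi lo' hi' a b :
  {homo phi : x y / x <= y} ->
  (forall s, a <= s <= b -> f s <= lo -> g (phi s) <= lo') ->
  (forall s, a <= s <= b -> hi <= f s -> hi' <= g (phi s)) ->
  rises f n lo hi a b -> rises g n lo' hi' (phi a) (phi b).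
Proof.
move=> phi_le; elim: n a => [|n IH] a flo fhi /=; first exact: phi_le.
move=> [p [q [ap pq fp fq r]]]; have qb := rises_le r.
exists (phi p), (phi q); split; [exact: phi_le|exact: phi_le| | |].
- by apply: flo => //; apply/andP; split; lra.
- by apply: fhi => //; apply/andP; split; lra.
- by apply: IH r => s sb; [apply: flo|apply: fhi]; apply/andP; split; lra.
Qed.

Lemma rises_mono f n lo hi lo' hi' a b : lo <= lo' -> hi' <= hi ->
  rises f n lo hi a b -> rises f n lo' hi' a b.
Proof.
by move=> lolo hihi; apply: (@rises_map f f id) => // s _ ?; lra.
Qed.

(* Between two consecutive rises there is a fall. *)
Lemma risesN f n lo hi a b :
  rises f n.+1 lo hi a b -> rises (fun x => - f x) n (- hi) (- lo) a b.
Proof.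
elim: n a => [|n IH] a [p [q [ap pq fp fq r]]].
  by rewrite /=; move: r => /=; lra.
have [p' [q' [qp' pq' fp' fq' r']]] := r.
exists q, p'; split; [lra|lra|lra|lra|].
apply: IH; exists p', q'; split=> //.
Qed.

Lemma rises_points f n lo hi a b : rises f n lo hi a b ->
  exists p q : nat -> R,
    [/\ forall i, (i < n)%N -> a <= p i /\ q i <= b,
        forall i, (i < n)%N -> p i <= q i,
        forall i, (i < n)%N -> f (p i) <= lo /\ hi <= f (q i)
      & forall i j, (i < j < n)%N -> q i <= p j].
Proof.
elim: n a => [|n IH] a /=.
  by exists (fun=> 0), (fun=> 0); split=> // i j; rewrite ltn0 andbF.
move=> [p0 [q0 [ap pq fp fq r]]]; have qb := rises_le r.
have [p [q [pqab pq' fpq qp]]] := IH _ r.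
exists (fun i => if i is i'.+1 then p i' else p0).
exists (fun i => if i is i'.+1 then q i' else q0).
split.
- by case=> [|i] ni //=; have := pqab i ni; lra.
- by case=> [|i] ni //=; exact: pq'.
- by case=> [|i] ni //=; exact: fpq.
- case=> [|i] [|j] //=.
    by move=> jn; have [] := pqab j jn.
  by move=> ijn; exact: qp.
Qed.

End Rises.

(** * Rises give embeddings *)

Section Embedding.
Local Open Scope classical_set_scope.
Local Open Scope ring_scope.
Variables (R : realType) (T : R -> R).
Hypothesis contT : {within `[0 : R, 1], continuous T}.

(** Taking the last point of the sublevel set, rather than any preimage of [y], makes the choice
    nondecreasing in [y] although [T] need not be monotone. *)
Definition last_below (a b y : R) : R := sup [set x | a <= x <= b /\ T x <= y].

Lemma last_below_itv a b y : a <= b -> T a <= y -> a <= last_below a b y <= b.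
Proof.
move=> ab Ta; have inA : [set x | a <= x <= b /\ T x <= y] a.
  by split=> //; rewrite lexx.
apply/andP; split.
  by apply: ub_le_sup => //; exists b => x [/andP[]].
by apply: ge_sup; [exists a|move=> x [/andP[]]].
Qed.

Lemma last_below_mono a b y z : a <= b -> T a <= y -> y <= z ->
  last_below a b y <= last_below a b z.
Proof.
move=> ab Ta yz; apply: ge_sup.
  by exists a; split=> //; rewrite lexx.
move=> x [xab Tx]; apply: ub_le_sup; first by exists b => u [/andP[]].
by split=> //; apply: le_trans yz.
Qed.

Lemma last_belowK a b y : 0 <= a -> a <= b -> b <= 1 -> T a <= y <= T b ->
  T (last_below a b y) = y.
Proof.
move=> a0 ab b1 /andP[Ta Tb].
have /andP[sa sb] := last_below_itv ab Ta.
set s := last_below a b y in sa sb *.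
apply/eqP; rewrite eq_le; apply/andP; split.
(* The sublevel set is closed, so it contains its supremum [s]. *)
- have /continuous_closedP/(_ [set z | z <= y] (@closed_le _ y)) := contT.
  move=> /closed_subspaceP[V cV VE].
  have VEx x : 0 <= x <= 1 -> V x <-> T x <= y.
    move=> x01; have x01' : [set` `[0 : R, 1]] x by rewrite /= in_itv.
    split=> h.
      have : (V `&` [set` `[0 : R, 1]]) x by split.
      by rewrite VE => -[].
    by have : (V `&` [set` `[0 : R, 1]]) x by [rewrite VE; split]; case.
  apply/VEx; first by apply/andP; split; lra.
  rewrite [V](closure_id _).1//.
  apply: (@closure_subset _ [set x | a <= x <= b /\ T x <= y]).
    by move=> x [xab Tx]; apply/VEx => //; lra.
  apply: closure_sup; last by exists b => x [/andP[]].
  by exists a; split=> //; rewrite lexx.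
- rewrite leNgt; apply/negP => sy.
  have cs : {within `[s, b], continuous T}.
    apply: continuous_subspaceW contT => x /=; rewrite !in_itv /= => /andP[? ?].
    by apply/andP; split; lra.
  (* If [T s < y], a point after [s] at the intermediate height still lies in the sublevel set,
     beyond its supremum. *)
  have [|x] := @IVT R T s b ((T s + y) / 2) sb cs.
    by rewrite ge_min le_max; apply/andP; split; apply/orP; [left|right]; lra.
  rewrite in_itv /= => /andP[sx xb] Tx.
  have : x <= s.
    apply: ub_le_sup; first by exists b => u [/andP[]].
    by split; [apply/andP; split; lra|rewrite Tx; lra].
  move=> xs; have xsE : x = s by lra.
  by move: Tx; rewrite xsE; lra.
Qed.

(* [last_below] is a monotone right inverse of [T] on each rise, so that
   [x |-> (w |-> last_below (p w) (q w) (x (S w)))] is a monotone self-map of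
   the complete lattice of functions [Omega -> [c, d]]; its Knaster-Tarski
   fixed point is an embedding. *)
Lemma embedded_of_rises (Omega : finType) (S : Omega -> Omega) (c d : R) :
  0 <= c -> c < d -> d <= 1 -> rises T #|Omega| c d c d -> embedded_in S T.
Proof.
move=> c0 cd d1 /rises_points[p0 [q0 [pqcd pq Tpq qp]]].
pose p (w : Omega) := p0 (enum_rank w); pose q (w : Omega) := q0 (enum_rank w).
have pc w : c <= p w by have [] := pqcd _ (ltn_ord (enum_rank w)).
have qd w : q w <= d by have [] := pqcd _ (ltn_ord (enum_rank w)).
have pqw w : p w <= q w by apply: pq; exact: ltn_ord.
have Tp w : T (p w) <= c by have [] := Tpq _ (ltn_ord (enum_rank w)).
have Tq w : d <= T (q w) by have [] := Tpq _ (ltn_ord (enum_rank w)).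
have qpw w w' : (enum_rank w < enum_rank w')%N -> q w <= p w'.
  by move=> ww'; apply: qp; rewrite ww' ltn_ord.
pose s w y := last_below (p w) (q w) y.
have s_itv w y : c <= y -> p w <= s w y <= q w.
  by move=> cy; apply: last_below_itv => //; have := Tp w; lra.
have s_mono w y z : c <= y -> y <= z -> s w y <= s w z.
  by move=> cy yz; apply: last_below_mono => //; have := Tp w; lra.
(* [P] consists of the post-fixed points of the monotone map; [X] is their pointwise supremum. *)
pose P (u : Omega -> R) := forall w, c <= u w <= d /\ u w <= s w (u (S w)).
pose X w := sup [set u w | u in P].
have ubP w : has_ubound [set u w | u in P].
  by exists d => _ [u Pu <-]; have [/andP[]] := Pu w.
have Pc : P (fun=> c).
  move=> w; split; first by apply/andP; split; lra.
  by have := s_itv w c (lexx c); have := pc w; lra.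
have leX u w : P u -> u w <= X w by move=> Pu; apply: ub_le_sup => //; exists u.
have X_le w b : (forall u, P u -> u w <= b) -> X w <= b.
  move=> ub; apply: ge_sup; first by exists c; exists (fun=> c).
  by move=> _ [u Pu <-]; exact: ub.
have Xcd w : c <= X w <= d.
  apply/andP; split; first exact: (leX (fun=> c)).
  by apply: X_le => u Pu; have [/andP[]] := Pu w.
have XsX w : X w <= s w (X (S w)).
  apply: X_le => u Pu; have [_ uw] := Pu w; apply: le_trans uw _.
  by apply: s_mono; [have [/andP[]] := Pu (S w)|exact: leX].
have sX w : s w (X (S w)) = X w.
  apply/eqP; rewrite eq_le XsX andbT.
  (* The image of [X] is again post-fixed, hence at most [X]. *)
  apply: (leX (fun w => s w (X (S w)))) => w'; split.
    have := s_itv w' (X (S w')); have := pc w'; have := qd w'.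
    by have /andP[cX _] := Xcd (S w') => ? ? /(_ cX) ?; lra.
  by apply: s_mono; [have /andP[] := Xcd (S w')|exact: XsX].
have Xpq w : p w <= X w <= q w.
  by rewrite -sX; apply: s_itv; have /andP[] := Xcd (S w).
have TX w : T (X w) = X (S w).
  rewrite -[in LHS]sX; apply: last_belowK => //.
  - by have := pc w; lra.
  - by have := qd w; lra.
  - by have := Xcd (S w); have := Tp w; have := Tq w; lra.
(* Two rises can share only an endpoint, where [T] would be both at least [d] and at most [c]. *)
have Xlt w w' : (enum_rank w < enum_rank w')%N -> X w <> X w'.
  move=> /qpw qp' XX; have := Xpq w; have := Xpq w' => Xw' Xw.
  have qw : q w = p w' by lra.
  by have := Tp w'; have := Tq w; rewrite qw; lra.
exists X; split.
- move=> w w' XX; case: (ltngtP (enum_rank w) (enum_rank w')).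
  + by move=> /Xlt /(_ XX).
  + by move=> /Xlt /(_ (esym XX)).
  + by move=> /ord_inj/enum_rank_inj.
- by move=> w; rewrite in_itv /=; have := Xcd w; lra.
- by apply/funext => w /=; rewrite TX.
Qed.

End Embedding.

Lemma exists_expr_lt (R : realType) (r e : R) :
  0 < r < 1 -> 0 < e -> exists n, r ^+ n < e.
Proof.
move=> /andP[r0 r1] e0.
have /cvgrPdist_lt/(_ e e0)[n _ /(_ n (leqnn n))] :
  ((fun n => r ^+ n) @ \oo --> (0 : R))%classic.
  by apply: cvg_expr; rewrite gtr0_norm.
by rewrite sub0r normrN gtr0_norm ?exprn_gt0//; exists n.
Qed.

(** One zoom: a subcell of width [a] and height [b] multiplies the height gap [w] of the diagonal by
    [a / b]. *)
Lemma norm_contract (R : realType) (w a b r : R) k :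
  0 < a -> 0 < b -> a <= r * b ->
  `|w| <= r ^+ k -> `|w * a / b| <= r ^+ k.+1.
Proof.
move=> a0 b0 ab wk; rewrite !normrM normfV (gtr0_norm a0) (gtr0_norm b0).
rewrite ler_pdivrMr// exprSr -mulrA; apply: ler_pM => //; exact: ltW.
Qed.

(** * Self-affine cells *)

Section Cells.
Local Open Scope classical_set_scope.
Local Open Scope ring_scope.
Variables (R : realType) (T : R -> R).
Implicit Types (c a e b lo hi u v y : R).

Definition cell c a e b :=
  [/\ 0 < a, 0 <= c, c + a <= 1
    & forall s, 0 <= s <= 1 -> T (c + a * s) = e + b * T s].

Lemma cell_unit : cell 0 1 0 1.
Proof. by split; [lra..|move=> s _; rewrite !add0r !mul1r]. Qed.

Lemma cell_comp c a e b c' a' e' b' : cell c a e b -> cell c' a' e' b' ->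
  cell (c + a * c') (a * a') (e + b * e') (b * b').
Proof.
move=> [a0 c0 ca TE] [a0' c0' ca' TE']; split.
- exact: mulr_gt0.
- by nra.
- by nra.
- move=> s /andP[s0 s1].
  rewrite (_ : c + a * c' + a * a' * s = c + a * (c' + a' * s)); last by ring.
  rewrite TE; last by apply/andP; split; nra.
  by rewrite TE'; [ring|apply/andP].
Qed.

Lemma cell_rises n lo hi c a e b : cell c a e b -> 0 < b ->
  rises T n lo hi 0 1 -> rises T n (e + b * lo) (e + b * hi) c (c + a).
Proof.
move=> [a0 _ _ TE] b0.
move=> /(@rises_map _ T T (fun s => c + a * s) _ _ _
  (e + b * lo) (e + b * hi))/=.
rewrite mulr0 addr0 mulr1; apply.
- by move=> s t st; rewrite lerD2l ler_pM2l.
- by move=> s /TE -> Ts; rewrite lerD2l ler_pM2l.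
- by move=> s /TE -> Ts; rewrite lerD2l ler_pM2l.
Qed.

(** A copy with [b < 0] turns falls into rises, and [n + 1] rises guarantee only [n] falls. *)
Lemma cell_risesN n lo hi c a e b : cell c a e b -> b < 0 ->
  rises T n.+1 lo hi 0 1 -> rises T n (e + b * hi) (e + b * lo) c (c + a).
Proof.
move=> [a0 _ _ TE] b0 /risesN.
move=> /(@rises_map _ _ T (fun s => c + a * s) _ _ _
  (e + b * hi) (e + b * lo))/=.
rewrite mulr0 addr0 mulr1; apply.
- by move=> s t st; rewrite lerD2l ler_pM2l.
- by move=> s /TE -> Ts; rewrite lerD2l ler_nM2l//; lra.
- by move=> s /TE -> Ts; rewrite lerD2l ler_nM2l//; lra.
Qed.

(* In the coordinates in which the graph of [T] over a cell is again the graph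
   of [T] over [0, 1], the diagonal is a line; [u] and [v] are its heights
   above the two endpoints. *)
Definition diagonal_trace u v := exists c a e b,
  [/\ cell c a e b, b != 0, c = e + b * u & c + a = e + b * v].

Lemma diagonal_trace_unit : diagonal_trace 0 1.
Proof.
exists 0, 1, 0, 1; split; [exact: cell_unit|exact: oner_neq0|by ring..].
Qed.

(** The line through [(0, u)] and [(1, v)] is evaluated at the ends of the subcell, then read in its
    vertical coordinate. *)
Lemma diagonal_trace_comp u v c a e b :
  diagonal_trace u v -> cell c a e b -> b != 0 ->
  diagonal_trace ((u + (v - u) * c - e) / b) ((u + (v - u) * (c + a) - e) / b).
Proof.
move=> [c' [a' [e' [b' [C' b0' cE' aE']]]]] C b0.
exists (c' + a' * c), (a' * a), (e' + b' * e), (b' * b); split.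
- exact: cell_comp.
- by rewrite mulf_neq0.
- have -> : a' = b' * (v - u) by lra.
  by rewrite cE'; field.
- have -> : a' = b' * (v - u) by lra.
  by rewrite cE'; field.
Qed.

Hypothesis contT : {within `[0 : R, 1], continuous T}.

(** As [u] and [v] lie in [[lo, hi]], this band of heights, rescaled to the cell, contains
    [[c, c + a]]: rises across the band are rises across the cell's own interval. The spare rise
    pays for a possible reversal. *)
Lemma embedded_of_trace (Omega : finType) (S : Omega -> Omega) u v lo hi :
  diagonal_trace u v -> lo <= u <= hi -> lo <= v <= hi ->
  rises T #|Omega|.+1 lo hi 0 1 -> embedded_in S T.
Proof.
move=> [c [a [e [b [C b0 cE aE]]]]] /andP[lu uh] /andP[lv vh] r.
have [a0 c0 ca _] := C.
apply: (embedded_of_rises contT S c0 _ ca); first by lra.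
have [bp|bn|b0'] := ltgtP b 0; last by rewrite b0' eqxx in b0.
- apply: rises_mono (cell_risesN C bp r).
  + by rewrite cE lerD2l ler_nM2l.
  + by rewrite aE lerD2l ler_nM2l.
- have [p [q [ap pq _ _ r']]] := cell_rises C bn r.
  apply: (@rises_widen _ _ _ _ _ q (c + a)) => //; first by lra.
  apply: rises_mono r'.
  + by rewrite cE lerD2l ler_pM2l.
  + by rewrite aE lerD2l ler_pM2l.
Qed.

Definition crosses n y :=
  exists2 eps, 0 < eps & rises T n (y - eps) (y + eps) 0 1.

Lemma crosses_cell n y c a e b : cell c a e b -> 0 < b ->
  crosses n ((y - e) / b) ->
  exists2 eps, 0 < eps & rises T n (y - eps) (y + eps) c (c + a).
Proof.
move=> C b0 [eps eps0 /(cell_rises C b0) r].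
exists (b * eps); first exact: mulr_gt0.
have bE : b * ((y - e) / b) = y - e by rewrite mulrC divfK ?gt_eqF.
by apply: rises_mono r; rewrite mulrDr bE; lra.
Qed.

Lemma crosses_cellN n y c a e b : cell c a e b -> b < 0 ->
  crosses n.+1 ((y - e) / b) ->
  exists2 eps, 0 < eps & rises T n (y - eps) (y + eps) c (c + a).
Proof.
move=> C b0 [eps eps0 /(cell_risesN C b0) r].
exists (- b * eps); first by rewrite mulr_gt0 ?oppr_gt0.
have bE : b * ((y - e) / b) = y - e by rewrite mulrC divfK ?lt_eqF.
by apply: rises_mono r; rewrite mulrDr bE; lra.
Qed.

Lemma crosses_uniform n (delta : R) : 0 < delta ->
  (forall y, 0 < y < 1 -> crosses n y) ->
  exists2 eps, 0 < eps &
    forall y, delta <= y <= 1 - delta -> rises T n (y - eps) (y + eps) 0 1.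
Proof.
move=> d0 cr.
have /compact_near_coveringP nc := @segment_compact R delta (1 - delta).
have covered y : [set` `[delta, 1 - delta]] y ->
    \forall z \near y & eps \near (0 : R)^'+,
      rises T n (z - eps) (z + eps) 0 1.
  rewrite /= in_itv /= => /andP[dy yd].
  have [eps eps0 r] : crosses n y by apply: cr; apply/andP; split; lra.
  (* Half of the margin pays for moving the height, half for the new tolerance. *)
  exists (ball y (eps / 2), [set e | e < eps / 2]).
    split=> /=; first by apply: nbhsx_ballx; lra.
    by apply: nbhs_right_lt; lra.
  move=> [z e] /= [yz ee]; apply: rises_mono r;
    by move: yz; rewrite /ball /= ltr_norml; lra.
have nr := nc _ _ (fun eps z => rises T n (z - eps) (z + eps) 0 1) _ covered.
have [eps [eps0 r]] := filter_ex (filterI (nbhs_right_gt (0 : R)) (nr _)).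
by exists eps => // y yd; apply: r; rewrite /= in_itv.
Qed.

End Cells.

(** * Zipper maps *)

Section Zipper.
Variables (R : realType) (x1 y1 x2 y2 : R) (T : R -> R).
Hypothesis xs : [/\ 0 < x1, x1 < x2 & x2 < 1].
Hypothesis ys : [/\ 0 < y2, y2 < y1 & y1 < 1].
Hypothesis slopes : [/\ x1 < y1, x2 - x1 < y1 - y2 & 1 - x2 < 1 - y2].
Hypothesis zipT : is_zipper_map x1 y1 x2 y2 T.

(** * The three branches as cells, and their effect on traces *)

Lemma zipper_left : cell T 0 x1 0 y1.
Proof.
have [x1_gt0 x12 x2_lt1] := xs.
split; [exact: x1_gt0|exact: lexx|lra|move=> s /andP[s0 s1]].
rewrite !add0r; have [_ /(_ (x1 * s))] := zipT.
rewrite in_itv /= mulr_ge0 ?(ltW x1_gt0)//= => <-; last by nra.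
rewrite /zipper_op ifT; last by nra.
by rewrite [x1 * s]mulrC mulfK ?gt_eqF.
Qed.

Lemma zipper_middle : cell T x1 (x2 - x1) y1 (- (y1 - y2)).
Proof.
have [x1_gt0 x12 x2_lt1] := xs.
split; [lra..|move=> s /andP[s0 s1]].
have [[_ _ T0 T1] TE] := zipT.
(* At [s = 0] the point is [x1], which the operator assigns to the left branch; [T 0 = 0] and
   [T 1 = 1] reconcile the two values. *)
have [->|sn0] := eqVneq s 0.
  rewrite T0 !mulr0 !addr0 -TE ?in_itv /=; last by apply/andP; split; lra.
  by rewrite /zipper_op lexx divff ?gt_eqF// T1 mulr1.
have s_gt0 : 0 < s by rewrite lt_def sn0.
rewrite -TE; last by rewrite in_itv /=; apply/andP; split; nra.
rewrite /zipper_op ifF; last by apply/negbTE; rewrite -ltNge; nra.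
rewrite ifT; last by nra.
rewrite [x1 + _]addrC addrK [_ * s]mulrC mulfK ?mulNr// gt_eqF//; lra.
Qed.

Lemma zipper_right : cell T x2 (1 - x2) y2 (1 - y2).
Proof.
have [x1_gt0 x12 x2_lt1] := xs.
split; [lra..|move=> s /andP[s0 s1]].
have [[_ _ T0 T1] TE] := zipT.
have [->|sn0] := eqVneq s 0.
  rewrite T0 !mulr0 !addr0 -TE ?in_itv /=; last by apply/andP; split; lra.
  rewrite /zipper_op ifF ?lexx ?divff ?T1; [lra|lra|].
  by apply/negbTE; lra.
have s_gt0 : 0 < s by rewrite lt_def sn0.
rewrite -TE; last by rewrite in_itv /=; apply/andP; split; nra.
rewrite /zipper_op !ifF; [|by apply/negbTE; rewrite -ltNge; nra..].
rewrite [x2 + _]addrC addrK [_ * s]mulrC mulfK// gt_eqF//; lra.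
Qed.

(** By hypersensitivity the largest reciprocal slope is below 1; it bounds the factor by which a
    zoom shrinks the gap of a trace. *)
Lemma exists_contraction : exists2 r, 0 < r < 1 &
  [/\ x1 <= r * y1, x2 - x1 <= r * (y1 - y2) & 1 - x2 <= r * (1 - y2)].
Proof.
have [x1_gt0 x12 x2_lt1] := xs.
have [y2_gt0 y21 y1_lt1] := ys.
have [slope1 slope2 slope3] := slopes.
have le_ratio (r a b : R) : 0 < b -> a / b <= r -> a <= r * b.
  by move=> b0; rewrite ler_pdivrMr.
have ratio_lt1 (a b : R) : 0 < b -> a < b -> a / b < 1.
  by move=> b0 ab; rewrite ltr_pdivrMr// mul1r.
exists (Num.max (x1 / y1) (Num.max ((x2 - x1) / (y1 - y2))
  ((1 - x2) / (1 - y2)))).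
  rewrite lt_max divr_gt0//=; last by lra.
  by rewrite !gt_max !ratio_lt1//; lra.
by split; apply: le_ratio; rewrite ?le_max ?lexx ?orbT//; lra.
Qed.

Lemma trace_left u v : diagonal_trace T u v ->
  diagonal_trace T (u / y1) ((u + (v - u) * x1) / y1).
Proof.
have [y2_gt0 y21 y1_lt1] := ys.
move=> t; have := diagonal_trace_comp t zipper_left.
rewrite mulr0 addr0 add0r !subr0; apply.
by rewrite gt_eqF//; lra.
Qed.

Lemma trace_middle u v : diagonal_trace T u v ->
  diagonal_trace T ((y1 - (u + (v - u) * x1)) / (y1 - y2))
    ((y1 - (u + (v - u) * x2)) / (y1 - y2)).
Proof.
have [y2_gt0 y21 y1_lt1] := ys.
move=> t; have := diagonal_trace_comp t zipper_middle.
rewrite [x1 + _]addrC subrK !invrN !mulrN -!mulNr !opprB; apply.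
by rewrite lt_eqF//; lra.
Qed.

Lemma trace_right u v : diagonal_trace T u v ->
  diagonal_trace T ((u + (v - u) * x2 - y2) / (1 - y2)) ((v - y2) / (1 - y2)).
Proof.
have [y2_gt0 y21 y1_lt1] := ys.
move=> t; have := diagonal_trace_comp t zipper_right.
rewrite [x2 + _]addrC subrK mulr1 [u + (v - u)]addrC subrK; apply.
by rewrite gt_eqF//; lra.
Qed.

(** * Crossings of horizontal lines and flat traces *)

Lemma crosses_one y : 0 < y < 1 -> crosses T 1 y.
Proof.
move=> /andP[y0 y_lt1]; have [[_ _ T0 T1] _] := zipT.
exists (Num.min y (1 - y)); first by rewrite lt_min; apply/andP; split; lra.
exists 0, 1; rewrite T0 T1 /=; split=> //.
  by rewrite subr_ge0 ge_min lexx.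
by rewrite -lerBrDl ge_min lexx orbT.
Qed.

Lemma crosses_left n y : crosses T n (y / y1) ->
  exists2 eps, 0 < eps & rises T n (y - eps) (y + eps) 0 x1.
Proof.
have [y2_gt0 y21 y1_lt1] := ys.
have := @crosses_cell R T n y _ _ _ _ zipper_left.
by rewrite subr0 add0r; apply; lra.
Qed.

Lemma crosses_right n y : crosses T n ((y - y2) / (1 - y2)) ->
  exists2 eps, 0 < eps & rises T n (y - eps) (y + eps) x2 1.
Proof.
have [y2_gt0 y21 y1_lt1] := ys.
have := @crosses_cell R T n y _ _ _ _ zipper_right.
by rewrite [x2 + _]addrC subrK; apply; lra.
Qed.

Lemma crosses_middle n y : crosses T n.+1 ((y1 - y) / (y1 - y2)) ->
  exists2 eps, 0 < eps & rises T n (y - eps) (y + eps) x1 x2.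
Proof.
have [y2_gt0 y21 y1_lt1] := ys.
have := @crosses_cellN R T n y _ _ _ _ zipper_middle.
rewrite [x1 + _]addrC subrK invrN mulrN -mulNr [- (y - y1)]opprB.
by apply; lra.
Qed.

Lemma crosses_left_right n m y :
  crosses T n (y / y1) -> crosses T m ((y - y2) / (1 - y2)) ->
  crosses T (n + m) y.
Proof.
have [_ x12 _] := xs.
move=> /crosses_left[e e0 l] /crosses_right[f f0 r].
exists (Num.min e f); first by rewrite lt_min e0.
have [ef ee] : Num.min e f <= f /\ Num.min e f <= e.
  by rewrite !ge_min !lexx orbT.
apply: (@rises_cat _ _ _ _ _ _ _ x2).
  by apply: rises_widen (lexx 0) (ltW x12) _; apply: rises_mono l; lra.
by apply: rises_mono r; lra.
Qed.

(** The reversed middle branch preserves the height [1 / 2] and loses one rise, while the outer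
    branches contribute one each: a net gain of one. *)
Lemma crosses_symmetric n : y1 + y2 = 1 -> crosses T n.+1 (1 / 2).
Proof.
have [x1_gt0 x12 x2_lt1] := xs; have [y2_gt0 y21 y1_lt1] := ys.
move=> yE; elim: n => [|n IH].
  by apply: crosses_one; apply/andP; split; lra.
have [|e e0 l] := @crosses_left 1 (1 / 2).
  apply: crosses_one; rewrite divr_gt0 ?ltr_pdivrMr ?mul1r//=; lra.
have [|f f0 r] := @crosses_right 1 (1 / 2).
  apply: crosses_one; rewrite divr_gt0 ?ltr_pdivrMr ?mul1r//=; lra.
have [|g g0 m] := @crosses_middle n (1 / 2).
  rewrite (_ : (y1 - 1 / 2) / (y1 - y2) = 1 / 2)//.
  have -> : y1 - 1 / 2 = (y1 - y2) * (1 / 2) by lra.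
  by rewrite mulrC mulKf// gt_eqF//; lra.
pose h := Num.min e (Num.min f g).
have [he hf hg] : [/\ h <= e, h <= f & h <= g].
  by rewrite /h !ge_min !lexx !orbT.
exists h; first by rewrite /h !lt_min e0 f0.
have -> : n.+2 = (1 + (n + 1))%N by rewrite addn1.
apply: (@rises_cat _ _ _ _ _ _ _ x1); first by apply: rises_mono l; lra.
apply: (@rises_cat _ _ _ _ _ _ _ x2); first by apply: rises_mono m; lra.
by apply: rises_mono r; lra.
Qed.

(* A trace with [u + v = 1] passes through the centre [(1/2, 1/2)], and the
   middle cell preserves this when the zipper is symmetric. *)
Lemma trace_symmetric (eps : R) : x1 + x2 = 1 -> y1 + y2 = 1 -> 0 < eps ->
  exists u v, [/\ diagonal_trace T u v, u + v = 1 & `|v - u| < eps].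
Proof.
have [x1_gt0 x12 x2_lt1] := xs; have [y2_gt0 y21 y1_lt1] := ys.
move=> xE yE eps0; have [r r01 [_ r2 _]] := exists_contraction.
have [k rk] := exists_expr_lt r01 eps0.
suff [u [v [t uv uvk]]] : exists u v,
    [/\ diagonal_trace T u v, u + v = 1 & `|v - u| <= r ^+ k].
  by exists u, v; split=> //; exact: le_lt_trans rk.
elim: k {rk} => [|k [u [v [t uv uvk]]]].
  exists 0, 1; split; [exact: diagonal_trace_unit|lra|].
  by rewrite subr0 normr1 expr0.
have y120 : y1 - y2 != 0 by rewrite gt_eqF//; lra.
have vE : v = 1 - u by lra.
have x2E : x2 = 1 - x1 by lra.
have y2E : y2 = 1 - y1 by lra.
eexists; eexists; split; first exact: (trace_middle t).
  apply: (mulIf y120); rewrite mulrDl !divfK// vE x2E y2E; ring.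
rewrite -mulrBl (_ : _ - _ - _ = (u - v) * (x2 - x1)); last by ring.
by apply: norm_contract; rewrite 1?distrC//; lra.
Qed.

(* [0 < u] and [v < 1] say that the corners of the cell lie strictly on
   opposite sides of the diagonal; this passes to the left or to the right
   subcell. *)
Lemma trace_flat (eps : R) : 0 < eps -> exists u v,
  [/\ diagonal_trace T u v, 0 < u, v < 1 & `|v - u| < eps].
Proof.
have [x1_gt0 x12 x2_lt1] := xs; have [y2_gt0 y21 y1_lt1] := ys.
have [slope1 slope2 slope3] := slopes.
move=> eps0; have [r r01 [r1 r2 r3]] := exists_contraction.
have /andP[r0 r_lt1] := r01.
have [k rk] := exists_expr_lt r01 eps0.
suff [u [v [t u0 v1 uvk]]] : exists u v,
    [/\ diagonal_trace T u v, 0 < u, v < 1 & `|v - u| <= r ^+ k].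
  by exists u, v; split=> //; exact: le_lt_trans rk.
elim: k {rk} => [|k [u [v [t u0 v1 uvk]]]].
  (* The unit trace [(0, 1)] is not strict, so the induction starts at the middle cell, where
     [x1 < y1] and [y2 < x2] give strictness. *)
  eexists; eexists; split; first exact: trace_middle (diagonal_trace_unit T).
  - rewrite divr_gt0//; lra.
  - rewrite ltr_pdivrMr; lra.
  - rewrite -mulrBl (_ : _ - _ - _ = - (x2 - x1)); last by ring.
    rewrite normrM normfV normrN !gtr0_norm; [|lra..].
    rewrite expr0 ler_pdivrMr; lra.
have rk1 : r ^+ k <= 1 by rewrite exprn_ile1// ltW.
have [uv_le uv_ge] : v - u <= 1 /\ - 1 <= v - u.
  by move: uvk; rewrite ler_norml => /andP[]; lra.
(* If the line is at height at least [y1] above [x1], it is still above [y2] at [x2]: it drops by at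
   most [x2 - x1 < y1 - y2]. *)
have [left_ok|right_ok] := ltP (u + (v - u) * x1) y1.
- eexists; eexists; split; first exact: (trace_left t).
  + by rewrite divr_gt0//; lra.
  + by rewrite ltr_pdivrMr; lra.
  + rewrite -mulrBl addrAC subrr add0r.
    by apply: norm_contract => //; lra.
- eexists; eexists; split; first exact: (trace_right t).
  + by rewrite divr_gt0//; nra.
  + by rewrite ltr_pdivrMr; lra.
  + rewrite -mulrBl (_ : _ - _ - _ = (v - u) * (1 - x2)); last by ring.
    by apply: norm_contract => //; lra.
Qed.

(** For heights in [(y2, y1)] both outer branches are crossed, which adds one rise; any other height
    is first zoomed into this range. *)
Lemma crosses_all n y : y2 < y1 ^+ 2 -> (2 - y2) * y2 < y1 ->
  0 < y < 1 -> crosses T n.+1 y.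
Proof.
have [y2_gt0 y21 y1_lt1] := ys.
move=> h1 h2; elim: n y => [|n IH] y; first exact: crosses_one.
have mid z : y2 < z < y1 -> crosses T n.+2 z.
  move=> /andP[z2 z1]; rewrite -addn1; apply: crosses_left_right.
    by apply: IH; rewrite divr_gt0 ?ltr_pdivrMr ?mul1r//; lra.
  by apply: crosses_one; rewrite divr_gt0 ?ltr_pdivrMr ?mul1r//; lra.
(* Each zoom into the left branch divides [z] by [y1]. From [z <= y2] it cannot jump past [y1],
   because [y2 / y1 < y1]. *)
have low N z : y2 * y1 ^+ N < z -> z < y1 -> crosses T n.+2 z.
  elim: N z => [|N IHN] z; first by rewrite expr0 mulr1 => *; apply/mid/andP.
  move=> zN z1; have [z2|z2] := ltP y2 z; first by apply/mid/andP.
  have [|e e0 l] := @crosses_left n.+2 z.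
    apply: IHN; first by rewrite ltr_pdivlMr -?mulrA -?exprSr//; lra.
    by rewrite ltr_pdivrMr; nra.
  exists e => //; apply: rises_widen l => //; have [] := xs; lra.
(* Likewise the right branch divides [1 - z] by [1 - y2], and [(y1 - y2) / (1 - y2) > y2] keeps the
   new height above [y2]. *)
have high N z : (1 - y1) * (1 - y2) ^+ N < 1 - z -> y2 < z -> crosses T n.+2 z.
  elim: N z => [|N IHN] z.
    by rewrite expr0 mulr1 => *; apply: mid; apply/andP; split; lra.
  move=> zN z2; have [z1|z1] := ltP z y1; first by apply/mid/andP.
  have [|e e0 l] := @crosses_right n.+2 z.
    apply: IHN; last by rewrite ltr_pdivlMr; nra.
    rewrite (_ : 1 - (z - y2) / (1 - y2) = (1 - z) / (1 - y2)).
      by rewrite ltr_pdivlMr -?mulrA -?exprSr//; lra.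
    by field; rewrite gt_eqF//; lra.
  exists e => //; apply: rises_widen l => //; have [] := xs; lra.
move=> /andP[y_gt0 y_lt1]; have [yy1|yy1] := ltP y y1.
  have [|N yN] := @exists_expr_lt _ y1 y _ y_gt0.
    by apply/andP; split; lra.
  apply: (low N) => //; have : 0 < y1 ^+ N by apply: exprn_gt0; lra.
  nra.
have [||N yN] := @exists_expr_lt _ (1 - y2) (1 - y).
- by apply/andP; split; lra.
- by lra.
- apply: (high N); last by lra.
  have : 0 < (1 - y2) ^+ N by apply: exprn_gt0; lra.
  nra.
Qed.

(** * Flat traces away from the heights 0 and 1 *)

(** Left subcells divide [u] by [y1] until it reaches [y2]; a gap below [y1 - y2] keeps the line
    under [y1] meanwhile. *)
Lemma trace_raise (eta u v : R) : eta <= y1 - y2 -> diagonal_trace T u v ->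
  0 < u -> v < 1 -> `|v - u| < eta ->
  exists u' v', [/\ diagonal_trace T u' v', y2 <= u', v' < 1
                  & `|v' - u'| < eta].
Proof.
have [x1_gt0 x12 x2_lt1] := xs; have [y2_gt0 y21 y1_lt1] := ys.
have [slope1 _ _] := slopes.
move=> etay t u0 v1 uv.
have [|N yN] := @exists_expr_lt _ y1 u _ u0; first by apply/andP; split; lra.
have {yN} : y2 * y1 ^+ N <= u.
  have : 0 < y1 ^+ N by apply: exprn_gt0; lra.
  nra.
elim: N u v t u0 v1 uv => [|N IH] u v t u0 v1 uv.
  by rewrite expr0 mulr1 => ?; exists u, v.
move=> uN; have [u2|u2] := leP y2 u; first by exists u, v.
apply: (IH _ _ (trace_left t)).
- by rewrite divr_gt0//; lra.
- rewrite ltr_pdivrMr; last by lra.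
  move: uv; rewrite ltr_norml => /andP[]; nra.
- rewrite -mulrBl addrAC subrr add0r.
  apply: le_lt_trans uv; rewrite -mulrA normrM ler_piMr// ger0_norm.
    by rewrite ler_pdivrMr; lra.
  by rewrite divr_ge0//; lra.
- by rewrite ler_pdivlMr -?mulrA -?exprSr//; lra.
Qed.

(** Right subcells divide [1 - v] by [1 - y2] until [v <= y1]. As long as [v > y1], the small gap
    keeps the line at least [(y1 - y2) / 2] above [y2], hence the new [u] above [kappa]. *)
Lemma trace_lower (kappa eta u v : R) : kappa <= (y1 - y2) / 2 ->
  eta <= (y1 - y2) / 2 -> diagonal_trace T u v ->
  kappa <= u -> v < 1 -> `|v - u| < eta ->
  exists u' v', [/\ diagonal_trace T u' v', kappa <= u', v' <= y1
                  & `|v' - u'| < eta].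
Proof.
have [x1_gt0 x12 x2_lt1] := xs; have [y2_gt0 y21 y1_lt1] := ys.
have [_ _ slope3] := slopes.
move=> kappay etay t u0 v1 uv.
have [||N yN] := @exists_expr_lt _ (1 - y2) (1 - v).
- by apply/andP; split; lra.
- by lra.
have {yN} : (1 - y1) * (1 - y2) ^+ N <= 1 - v.
  have : 0 < (1 - y2) ^+ N by apply: exprn_gt0; lra.
  nra.
elim: N u v t u0 v1 uv => [|N IH] u v t u0 v1 uv.
  by rewrite expr0 mulr1 => ?; exists u, v; split=> //; lra.
move=> uN; have [v2|v2] := leP v y1; first by exists u, v.
apply: (IH _ _ (trace_right t)).
- rewrite ler_pdivlMr; last by lra.
  apply: (@le_trans _ _ ((y1 - y2) / 2)); first by nra.
  move: uv; rewrite ltr_norml => /andP[]; nra.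
- by rewrite ltr_pdivrMr; lra.
- rewrite -mulrBl (_ : _ - _ - _ = (v - u) * (1 - x2)); last by ring.
  apply: le_lt_trans uv; rewrite -mulrA normrM ler_piMr// ger0_norm.
    by rewrite ler_pdivrMr; lra.
  by rewrite divr_ge0//; lra.
- rewrite (_ : 1 - (v - y2) / (1 - y2) = (1 - v) / (1 - y2)).
    by rewrite ler_pdivlMr -?mulrA -?exprSr//; lra.
  by field; rewrite gt_eqF//; lra.
Qed.

(** [delta] must not depend on [eps]: it first determines a uniform crossing margin, and the trace
    is then made flatter than that margin. *)
Lemma trace_central : exists2 delta, 0 < delta & forall eps, 0 < eps ->
  exists u v, [/\ diagonal_trace T u v, delta <= u <= 1 - delta
                & `|v - u| < eps].
Proof.
have [y2_gt0 y21 y1_lt1] := ys.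
pose kappa := Num.min y2 ((y1 - y2) / 2).
have kappa0 : 0 < kappa by rewrite lt_min; apply/andP; split; lra.
have kappay : kappa <= (y1 - y2) / 2 by rewrite ge_min lexx orbT.
have kappay2 : kappa <= y2 by rewrite ge_min lexx.
pose delta := Num.min kappa ((1 - y1) / 2).
have delta0 : 0 < delta by rewrite lt_min; apply/andP; split; lra.
have deltak : delta <= kappa by rewrite ge_min lexx.
have deltay : delta <= (1 - y1) / 2 by rewrite ge_min lexx orbT.
exists delta => // eps eps0.
pose eta := Num.min eps delta.
have eta0 : 0 < eta by rewrite lt_min eps0.
have etad : eta <= delta by rewrite ge_min lexx orbT.
have [u [v [t u0 v1 uv]]] := trace_flat eta0.
have [|u' [v' [t' u0' v1' uv']]] := trace_raise _ t u0 v1 uv; first by lra.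
have [||u'' [v'' [t'' u0'' v1'' uv'']]] :=
  trace_lower kappay _ t' _ v1' uv'; [by lra|by lra|].
exists u'', v''; split=> //.
- by move: uv''; rewrite ltr_norml => /andP[? ?]; apply/andP; split; lra.
- by apply: lt_le_trans uv'' _; rewrite ge_min lexx.
Qed.

Lemma zipper_embedded (Omega : finType) (S : Omega -> Omega) :
  (x1 + x2 = 1 /\ y1 + y2 = 1) \/ (y2 < y1 ^+ 2 /\ (2 - y2) * y2 < y1) ->
  embedded_in S T.
Proof.
have [[contT _ _ _] _] := zipT.
move=> [[xE yE]|[h1 h2]].
- have [eps eps0 r] := crosses_symmetric #|Omega| yE.
  have [u [v [t uv1 uv]]] := trace_symmetric xE yE eps0.
  (* With [u + v = 1], a gap below [eps] puts both heights within [eps] of [1 / 2]. *)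
  move: uv; rewrite ltr_norml => /andP[? ?].
  by apply: (embedded_of_trace contT S t _ _ r); apply/andP; split; lra.
- have [delta delta0 central] := trace_central.
  have [eps eps0 r] := crosses_uniform delta0
    (fun y => @crosses_all #|Omega| y h1 h2).
  have [u [v [t ud uv]]] := central _ eps0.
  move: uv; rewrite ltr_norml => /andP[? ?].
  by apply: (embedded_of_trace contT S t _ _ (r u ud)); apply/andP; split; lra.
Qed.

End Zipper.

Theorem corollary3 (R : realType) (x1 y1 x2 y2 : R) (T : R -> R)
    (hx1 : 0 < x1 < 1) (hy1 : 0 < y1 < 1) (hx2 : 0 < x2 < 1) (hy2 : 0 < y2 < 1)
    (hx : x1 < x2) (hy : y2 < y1)
    (hT : is_zipper_map x1 y1 x2 y2 T)
    (hyper : 1 < Num.min (y1 / x1)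
                   (Num.min ((y1 - y2) / (x2 - x1)) ((1 - y2) / (1 - x2))))
    (hcase : (x1 + x2 = 1 /\ y1 + y2 = 1) \/
             (y2 < y1 ^+ 2 /\ (2 - y2) * y2 < y1))
    (Omega : finType) (S : Omega -> Omega) :
  embedded_in S T.
Proof.
move: hx1 hy1 hx2 hy2 => /andP[x10 x11] /andP[y10 y11].
move=> /andP[x20 x21] /andP[y20 y21].
apply: (zipper_embedded _ _ _ hT) hcase; split=> //.
all: move: hyper; rewrite !lt_min !ltr_pdivlMr ?mul1r; try lra.
all: by case/and3P.
Qed.
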